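(* Let $\beta>1$ satisfy $\beta^3=\beta^2+\beta+1$. For positive integers $M$, as $M\to\infty$, $$\frac1{2M+1}\sum_{N=-M}^M\|N\|_T=\frac{\beta^3}{\beta^5+1}\,\frac{\log M}{\log\beta}+\mathcal O(1).$$
   Context: Tribonacci numeration system: $T_0=1$, $T_1=2$, $T_2=4$, $T_n=T_{n-1}+T_{n-2}+T_{n-3}$ for $n\ge3$. A word $x=x_1\cdots x_n$ over $\mathbb Z$ represents $\sum_{j=1}^n x_jT_{n-j}$; $\|x\|=\sum_j|x_j|$. For $N\in\mathbb Z$, $\|N\|_T$ is the weight of a $T$-expansion of minimal weight of $N$, i.e. the minimum of $\|x\|$ over all words $x\in\mathbb Z^*$ representing $N$. *)

(* Defs.v *)
From HB Require Import structures.
From mathcomp Require Import all_boot all_order all_algebra.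
From mathcomp Require Import all_classical all_reals all_analysis.

Set Implicit Arguments.
Unset Strict Implicit.
Unset Printing Implicit Defensive.

Import Order.TTheory GRing.Theory Num.Theory.
Local Open Scope ring_scope.

Fixpoint tribonacci (n : nat) : nat :=
  match n with
  | 0 => 1
  | 1 => 2
  | 2 => 4
  | (((m.+1) as m1).+1 as m2).+1 =>
      tribonacci m2 + tribonacci m1 + tribonacci m
  end%N.

(* Most significant digit first: with 0-based indexing the digit [x`_j] has
   place value T_(n-1-j), where n is the length of the word. *)
Definition word_value (x : seq int) : int :=
  \sum_(j < size x) x`_j * (tribonacci (size x - j.+1))%:Z.

Definition word_weight (x : seq int) : nat := (\sum_(c <- x) `|c|)%N.

Definition has_expansion_of_weight (N : int) (w : nat) : Prop :=
  exists x : seq int, word_value x = N /\ word_weight x = w.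

(* Every integer has an expansion, namely the one-letter word [:: N]. *)
Lemma expansion_exists (N : int) :
  exists w : nat, `[< has_expansion_of_weight N w >].
Proof.
exists `|N|%N; apply/asboolP; exists [:: N]; split.
  by rewrite /word_value big_ord1 /= mulr1.
by rewrite /word_weight big_seq1.
Qed.

Definition T_norm (N : int) : nat := ex_minn (expansion_exists N).

Definition average_T_norm (R : realType) (M : nat) : R :=
  (\sum_(i < (2 * M).+1) (T_norm (i%:Z - M%:Z))%:R) / (2 * M + 1)%:R.

(* Main.v *)
Require Import Defs.
From mathcomp Require Import all_boot all_order all_algebra.
From mathcomp Require Import all_classical all_reals all_analysis.
From mathcomp Require Import zify ring lra.
Import Order.TTheory GRing.Theory Num.Theory.
Import numFieldNormedType.Exports.
Local Open Scope classical_set_scope.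
Local Open Scope ring_scope.

Set Implicit Arguments.
Unset Strict Implicit.
Unset Printing Implicit Defensive.

(** Call a word over {-1, 0, 1} regular if it avoids the factors 11, 101, 1(-1)
and their negatives.  The regular words of length n represent, without
repetition, the integers of an interval [-m_n, m_n] whose size is a Tribonacci
sequence.  A regular word has minimal weight: adding a single term +-T_k raises
the weight of the regular expansion by at most 1, because reading the regular
expansions of N and N + T_k simultaneously from the left leaves only finitely
many configurations, on which the weight difference is bounded by inspection.

Deleting the leading digit of a regular word gives ||T_k + u|| = 1 + ||u|| for u
in an interval around 0, hence a recursion for the sums of norms over the
intervals [0, m_k].  It is the Tribonacci recursion with a resonant forcing
term, which the constant beta^3 / (beta^5 + 1) cancels up to a bounded sequence.
A second induction on the same self-similarity interpolates between the m_k. *)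

(** * Shifted Tribonacci numbers *)

(* [trib k.+2] is T_k; the two extra terms T_(-2) = 0 and T_(-1) = 1 let the
   recurrence hold from the start. *)
Definition trib (n : nat) : int :=
  match n with 0%N => 0 | 1%N => 1 | m.+2 => (tribonacci m)%:Z end.

Lemma tribE n : trib n.+3 = trib n.+2 + trib n.+1 + trib n.
Proof. by case: n => [//|[//|n]] /=; rewrite !PoszD. Qed.

Lemma trib_ge0 n : 0 <= trib n.
Proof. by case: n => [//|[//|n]]. Qed.

Arguments trib : simpl never.

Lemma trib_le n : trib n <= trib n.+1.
Proof.
case: n => [//|[//|[//|n]]]; rewrite (tribE n.+1).
by have := trib_ge0 n.+2; have := trib_ge0 n.+1; lia.
Qed.

Lemma trib_homo m n : (m <= n)%N -> trib m <= trib n.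
Proof.
elim: n => [|n IH]; first by rewrite leqn0 => /eqP->.
rewrite leq_eqVlt => /orP[/eqP->//|mn]; apply: le_trans (IH mn) (trib_le n).
Qed.

Lemma word_value_cons d x :
  word_value (d :: x) = d * trib (size x).+2 + word_value x.
Proof.
by rewrite /word_value /= big_ord_recl /= subSS subn0.
Qed.

Lemma word_weight_cons d x :
  word_weight (d :: x) = (`|d| + word_weight x)%N.
Proof. by rewrite /word_weight big_cons. Qed.

(** * Regular words *)

(* The letters that may follow a prefix: [None] is unconstrained,
   [Some (false, s)] means that the previous digit is nonzero, and
   [Some (true, s)] that it is 0 and the one before is nonzero; [s] holds when
   this nonzero digit is -1. *)
Definition mode : Type := option (bool * bool).

Definition unit_digit (s : bool) : int := if s then -1 else 1.

Definition moves (q : mode) : seq (int * mode) :=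
  match q with
  | None => [:: (0, None); (1, Some (false, false)); (-1, Some (false, true))]
  | Some (false, s) => [:: (0, Some (true, s))]
  | Some (true, s) => [:: (0, None); (unit_digit (~~ s), Some (false, ~~ s))]
  end.

Fixpoint regular (q : mode) (x : seq int) : bool :=
  if x is d :: x' then has (fun m => (m.1 == d) && regular m.2 x') (moves q)
  else true.

(* The offset between two words of which [r] letters are still to be read is an
   integer combination of T_r, T_(r-1) and T_(r-2). *)
Definition trib_form (v : int * int * int) (r : nat) : int :=
  v.1.1 * trib r.+2 + v.1.2 * trib r.+1 + v.2 * trib r.

Definition advance (v : int * int * int) (d : int) : int * int * int :=
  (v.1.1 + v.1.2 + d, v.1.1 + v.2, v.1.1).

Lemma trib_form_advance v d r :
  trib_form (advance v d) r = trib_form v r.+1 + d * trib r.+2.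
Proof. by rewrite /trib_form (tribE r) /=; ring. Qed.

(** In [r], [trib_form v] obeys the Tribonacci recurrence, so three values decide the sign for all
    lengths and inequalities between forms become finite checks. *)
Lemma trib_form_ge0 v : 0 <= trib_form v 0 -> 0 <= trib_form v 1 -> 0 <= trib_form v 2 ->
  forall r, 0 <= trib_form v r.
Proof.
move=> v0 v1 v2 r.
suff: [/\ 0 <= trib_form v r, 0 <= trib_form v r.+1 & 0 <= trib_form v r.+2].
  by case.
elim: r => [//|r [IH0 IH1 IH2]]; split=> //.
have -> : trib_form v r.+3 = trib_form v r.+2 + trib_form v r.+1 + trib_form v r.
  rewrite /trib_form (tribE r.+2) (tribE r.+1) (tribE r).
  by ring.
by apply: addr_ge0 => //; apply: addr_ge0.
Qed.

Definition opp_mode (q : mode) : mode :=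
  if q is Some (z, s) then Some (z, ~~ s) else None.

(* [trib_form (sup_form q) r] is 1 plus twice the largest value of a word of
   length [r] that is regular from [q]. *)
Definition sup_form (q : mode) : int * int * int :=
  match q with
  | Some (false, false) => (-1, 2, 1)
  | Some (true, false) | Some (false, true) => (1, 0, -1)
  | _ => (1, 0, 1)
  end.

Lemma moves_opp q d q' : (d, q') \in moves q ->
  (- d, opp_mode q') \in moves (opp_mode q).
Proof.
case: q => [[[] []]|]; rewrite !inE => H;
  by repeat (case/orP: H => H); move/eqP: H => [-> ->].
Qed.

Lemma regularP q d x : reflect (exists2 q', (d, q') \in moves q & regular q' x)
  (regular q (d :: x)).
Proof.
apply: (iffP hasP) => [[[d' q'] m /= /andP[/eqP<- r]]|[q' m r]]; first by exists q'.
by exists (d, q'); rewrite //= eqxx.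
Qed.

Lemma sup_form_moves q d q' r : (d, q') \in moves q ->
  2 * d * trib r.+2 + trib_form (sup_form q') r <= trib_form (sup_form q) r.+1.
Proof.
have := tribE r; have := trib_ge0 r; have := trib_le r; have := trib_le r.+1.
move=> le2 le1 ge0 E; case: q => [[[] []]|]; rewrite !inE => H;
  repeat (case/orP: H => H); move/eqP: H => [-> ->]; rewrite /trib_form /= E; lia.
Qed.

Lemma regular_lt q x : regular q x ->
  2 * word_value x < trib_form (sup_form q) (size x).
Proof.
elim: x q => [|d x IH] q; first by rewrite /word_value big_ord0; case: q => [[[] []]|].
move=> /regularP[q' m r]; rewrite word_value_cons /=.
by have := sup_form_moves (size x) m; have := IH _ r; lia.
Qed.

Lemma regular_opp q x : regular q x -> regular (opp_mode q) [seq - d | d <- x].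
Proof.
elim: x q => [//|d x IH] q /regularP[q' m r] /=.
by apply/regularP; exists (opp_mode q'); [exact: moves_opp|exact: IH].
Qed.

Lemma word_value_opp x : word_value [seq - d | d <- x] = - word_value x.
Proof.
elim: x => [|d x IH]; first by rewrite /word_value !big_ord0 oppr0.
by rewrite /= !word_value_cons IH size_map; ring.
Qed.

Lemma word_weight_opp x : word_weight [seq - d | d <- x] = word_weight x.
Proof.
by elim: x => [//|d x IH]; rewrite /= !word_weight_cons IH abszN.
Qed.

Lemma regular_gt q x : regular q x ->
  - trib_form (sup_form (opp_mode q)) (size x) < 2 * word_value x.
Proof.
move/regular_opp/regular_lt; rewrite word_value_opp size_map mulrN. by rewrite ltrNl.
Qed.

Lemma trib_odd n : exists k, trib n.+2 + trib n = 2 * k + 1.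
Proof.
elim: n => [|n [k IH]]; first by exists 0.
by exists (k + trib n.+1); rewrite tribE; lia.
Qed.

(** The intervals reached through the moves of [q] tile the interval of [q], so a leading digit can
    be chosen by comparing [u] with the endpoints. *)
Lemma regular_exists q r (u : int) :
  - trib_form (sup_form (opp_mode q)) r < 2 * u < trib_form (sup_form q) r ->
  exists x, [/\ regular q x, size x = r & word_value x = u].
Proof.
elim: r q u => [|r IH] q u.
  move=> h; exists [::]; split=> //; rewrite /word_value big_ord0.
  case: q h => [[[] []]|]; rewrite /trib_form /trib /= => h; lia.
move=> h.
have {}IH : forall d q', (d, q') \in moves q ->
  - trib_form (sup_form (opp_mode q')) r < 2 * (u - d * trib r.+2)
    < trib_form (sup_form q') r ->
  exists x, [/\ regular q x, size x = r.+1 & word_value x = u].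
  move=> d q' m /IH[x [rx sx vx]]; exists (d :: x); rewrite word_value_cons /= sx.
  by split=> //; [apply/regularP; exists q'|rewrite vx; ring].
have := tribE r; have := trib_ge0 r; have := trib_le r; have := trib_le r.+1.
(* With c = [trib r.+2 + trib r] odd, 2u is never c or -c, so the open intervals leave no gap. *)
move=> le2 le1 ge0 E; have [k odd_c] := trib_odd r.
have odd_gap (z : int) : 2 * u < z \/ z <= 2 * u by lia.
move: h; case: q IH => [[[] []]|] IH; rewrite /trib_form /= ?E => h.
- have [h'|h'] := odd_gap (trib r.+2 + trib r).
    by apply: (IH 0 None); rewrite ?inE // /trib_form /=; lia.
  by apply: (IH 1 (Some (false, false))); rewrite ?inE // /trib_form /=; lia.
- have [h'|h'] := odd_gap (1 - (trib r.+2 + trib r)).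
    by apply: (IH (-1) (Some (false, true))); rewrite ?inE // /trib_form /=; lia.
  by apply: (IH 0 None); rewrite ?inE // /trib_form /=; lia.
- by apply: (IH 0 (Some (true, true))); rewrite ?inE // /trib_form /=; lia.
- by apply: (IH 0 (Some (true, false))); rewrite ?inE // /trib_form /=; lia.
- have [h'|h'] := odd_gap (trib r.+2 + trib r); last first.
    by apply: (IH 1 (Some (false, false))); rewrite ?inE // /trib_form /=; lia.
  have [h2|h2] := odd_gap (1 - (trib r.+2 + trib r)).
    by apply: (IH (-1) (Some (false, true))); rewrite ?inE // /trib_form /=; lia.
  by apply: (IH 0 None); rewrite ?inE // /trib_form /=; lia.
Qed.

(** * Comparing the weights of two regular words *)

(* In ((v, (p, q)), (e, w)), the words x and y are still to be read from the
   modes [p] and [q], y exceeds x by [trib_form v], plus some T_k inside the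
   unread part if [e] holds, and [w] is the claimed bound on the weight of y
   minus that of x. *)
Definition config : Type :=
  (int * int * int) * (mode * mode) * (bool * int).

(** A sufficient test, uniform in the number r of unread letters, that the offset exceeds what
    regular words from [p] and [q] can make up. The pending term lies between 0 and T_(r-1), so it
    enters only the second inequality, in the middle coefficient. *)
Definition infeasible (s : int * int * int) (p q : mode) (e : bool) : bool :=
  let: (a, b, c) := s in
  let: (a1, b1, c1) := sup_form q in
  let: (a2, b2, c2) := sup_form (opp_mode p) in
  let: (a3, b3, c3) := sup_form (opp_mode q) in
  let: (a4, b4, c4) := sup_form p in
  let nonneg v := [&& 0 <= trib_form v 0, 0 <= trib_form v 1 & 0 <= trib_form v 2] in
  nonneg (2 * a - a1 - a2, 2 * b - b1 - b2, 2 * c - c1 - c2) ||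
  nonneg (- 2 * a - a3 - a4, - 2 * b - b3 - b4 - 2 * e%:Z, - 2 * c - c3 - c4).

(* [b] tells whether the pending T_k sits at the position being read. *)
Definition successor (cf : config) (m : (int * mode) * (int * mode)) (b : bool) :
    config :=
  (advance cf.1.1 (m.1.1 - m.2.1 + b%:Z), (m.1.2, m.2.2),
   (cf.2.1 && ~~ b, cf.2.2 + `|m.1.1| - `|m.2.1|)).

Definition successors (cf : config) : seq config :=
  [seq successor cf m b
    | m <- [seq (mp, mq) | mp <- moves cf.1.2.1, mq <- moves cf.1.2.2],
      b <- if cf.2.1 then [:: false; true] else [:: false]].

Definition feasible_successors (cf : config) : seq config :=
  [seq cf' <- successors cf |
    ~~ infeasible cf'.1.1 cf'.1.2.1 cf'.1.2.2 cf'.2.1].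

(** A finite certificate: [l] is stable under reading one letter. When nothing is left to read, both
    remaining weights are 0, so the claimed bound must be nonnegative. *)
Definition closed_configs (l : seq config) : bool :=
  all (fun cf => all (mem l) (feasible_successors cf) &&
    ((trib_form cf.1.1 0 == 0) ==> cf.2.1 || (0 <= cf.2.2))) l.

Definition offset (e : bool) (r : nat) (z : int) : Prop :=
  if e then exists2 k, (k < r)%N & z = trib k.+2 else z = 0.

Lemma feasible_offset s p q e r x y z : regular p x -> regular q y ->
  size x = r -> size y = r -> offset e r z ->
  word_value y = word_value x + trib_form s r + z -> ~~ infeasible s p q e.
Proof.
move=> /[dup] /regular_lt xlt /regular_gt xgt /[dup] /regular_lt ylt /regular_gt ygt.
move=> sx sy; rewrite sx in xlt xgt; rewrite sy in ylt ygt => ez vy.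
have [z0 z1] : 0 <= z /\ z <= e%:Z * trib r.+1.
  case: e ez => /= [[k kr ->]|->]; last by rewrite mul0r.
  by rewrite mul1r; split; [exact: trib_ge0|apply: trib_homo].
move: vy xlt xgt ylt ygt; rewrite /infeasible; case: s => [[a b] c].
case: (sup_form q) => [[a1 b1] c1]; case: (sup_form (opp_mode p)) => [[a2 b2] c2].
case: (sup_form (opp_mode q)) => [[a3 b3] c3]; case: (sup_form p) => [[a4 b4] c4].
move=> -> xlt xgt ylt ygt; apply/negP => /orP[] /and3P[] h0 h1 h2.
- have := trib_form_ge0 h0 h1 h2 r; move: xlt xgt ylt ygt; rewrite /trib_form /=.
  by nra.
- have := trib_form_ge0 h0 h1 h2 r; move: xlt xgt ylt ygt; rewrite /trib_form /=.
  by nra.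
Qed.

Lemma closed_configs_weight l cf : closed_configs l -> cf \in l -> forall x y z,
  regular cf.1.2.1 x -> regular cf.1.2.2 y -> size y = size x ->
  offset cf.2.1 (size x) z ->
  word_value y = word_value x + trib_form cf.1.1 (size x) + z ->
  (word_weight y)%:Z <= (word_weight x)%:Z + cf.2.2.
Proof.
move=> lP + x; elim: x cf => [|d x IH] cf cfP [|d' y]//= z.
  move=> _ _ _; case: cf cfP => [[s [p q]] [[] w]] cfP /=; first by case.
  move=> ->; rewrite /word_value !big_ord0 add0r addr0 => /esym s0.
  have /allP/(_ _ cfP)/andP[_] := lP.
  by rewrite /= s0 eqxx /= /word_weight !big_nil add0r.
move=> /regularP[p' mp xp] /regularP[q' mq yq] [sz] ez.
rewrite !word_value_cons !word_weight_cons sz => vy.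
(* One letter of each word is read; [b] holds when the pending T_k sits at this position and is
   absorbed into the offset. *)
have step b z' : b ==> cf.2.1 -> offset (cf.2.1 && ~~ b) (size x) z' ->
    z = z' + b%:Z * trib (size x).+2 ->
    (word_weight y)%:Z <= (word_weight x)%:Z + (cf.2.2 + `|d| - `|d'|).
  move=> bcf ez' zE.
  have vy' : word_value y =
      word_value x + trib_form (advance cf.1.1 (d - d' + b%:Z)) (size x) + z'.
    by rewrite trib_form_advance; move: vy; rewrite zE; nra.
  have := feasible_offset xp yq erefl sz ez' vy' => feas.
  apply: (IH (successor cf ((d, p'), (d', q')) b) _ _ _ xp yq sz ez' vy').
  have /allP/(_ _ cfP)/andP[/allP sub _] := lP.
  apply: sub; rewrite mem_filter feas /=.
  apply/allpairsP; exists (((d, p'), (d', q')), b); split=> //=.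
    by apply/allpairsP; exists ((d, p'), (d', q')).
  by move: bcf; case: (cf.2.1); case: (b).
suff h : (word_weight y)%:Z <= (word_weight x)%:Z + (cf.2.2 + `|d| - `|d'|).
  by rewrite !PoszD !abszE; lra.
move: ez; rewrite /offset; case: ifP => [e [k]|e zE]; last first.
  by apply: (step false 0); rewrite ?e ?zE ?mul0r.
rewrite ltnS leq_eqVlt => /orP[/eqP->|kx] zE.
  by apply: (step true 0); rewrite ?e //= zE mul1r add0r.
apply: (step false z); rewrite ?e //=; last by rewrite mul0r addr0.
by exists k.
Qed.

(* Eight rounds saturate: the result is a set of 93 configurations. *)
Definition configs : seq config :=
  iter 8 (fun l => undup (l ++ flatten (map feasible_successors l)))
    [:: ((0, 0, 0), (None, None), (true, 1));
        ((0, 0, 0), (None, None), (false, 0))].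

Lemma configs_closed : closed_configs configs.
Proof. by vm_compute. Qed.

Lemma regular_pad n x : (size x <= n)%N -> regular None x -> exists x',
  [/\ regular None x', size x' = n, word_value x' = word_value x &
      word_weight x' = word_weight x].
Proof.
elim: n => [|n IH]; first by rewrite leqn0 => /eqP sx rx; exists x.
rewrite leq_eqVlt => /orP[/eqP sx rx|xn rx]; first by exists x.
have [x' [rx' sx' vx' wx']] := IH xn rx.
exists (0 :: x'); rewrite word_value_cons word_weight_cons mul0r add0r /=.
by split; rewrite ?sx' ?rx'.
Qed.

Lemma regular_None q x : regular q x -> regular None x.
Proof.
elim: x q => [//|d x IH] q /regularP[q' m r]; apply/regularP.
have {}IH : regular None x by exact: (IH _ r).
case: q m => [[[] s]|] m; last by exists q'.
  move: m r; rewrite !inE => /orP[]/eqP[-> ->] r; first by exists None.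
  by exists (Some (false, ~~ s)) => //; case: (s).
by move: m; rewrite inE => /eqP[-> _]; exists None.
Qed.

Lemma regular_surj (N : int) : exists2 x, regular None x & word_value x = N.
Proof.
have growth r : 2 * r%:Z < trib r.+2 + trib r.
  elim: r => [//|r IH]; have pos : 1 <= trib r.+1.
    by case: r {IH} => [//|r]; apply: (@trib_homo 2).
  by rewrite tribE; lia.
have [|x [rx _ vx]] := @regular_exists None `|N|%N N; last by exists x.
by have := growth `|N|%N; rewrite /trib_form /=; lia.
Qed.

Lemma regular_weight_offset (e : bool) k x y : regular None x -> regular None y ->
  word_value y = word_value x + e%:Z * trib k.+2 ->
  (word_weight y <= word_weight x + e)%N.
Proof.
(* A common length above k, so that T_k has a position inside the padded words. *)
move=> rx ry; pose n := maxn (maxn (size x) (size y)) k.+1.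
have [|x' [rx' sx' <- <-]] := @regular_pad n x _ rx; first by rewrite /n; lia.
have [|y' [ry' sy' <- <-]] := @regular_pad n y _ ry; first by rewrite /n; lia.
move=> vy; rewrite -lez_nat PoszD.
have /(closed_configs_weight configs_closed) H :
  (((0, 0, 0), (None, None), (e, e%:Z)) : config) \in configs.
  by case: (e); vm_compute.
apply: (H _ _ (e%:Z * trib k.+2) rx' ry').
- by rewrite sx' sy'.
- case: (e) => /=; last by rewrite mul0r.
  by exists k; rewrite ?mul1r // sx' /n; lia.
- by rewrite vy /trib_form !mul0r !addr0.
Qed.

Lemma regular_weight_shift n k x y : regular None x -> regular None y ->
  word_value y = word_value x + n%:Z * trib k.+2 ->
  (word_weight y <= word_weight x + n)%N.
Proof.
elim: n y => [|n IH] y rx ry vy.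
  by apply: (@regular_weight_offset false k) => //; rewrite vy.
have [x' rx' vx'] := regular_surj (word_value x + n%:Z * trib k.+2).
apply: leq_trans (_ : word_weight x' + 1 <= _)%N.
  by apply: (@regular_weight_offset true k) => //; rewrite vy vx'; lia.
by have := IH _ rx rx' vx'; lia.
Qed.

(** Induction on the arbitrary word: its tail is replaced by a regular expansion, and the leading
    digit [d] then costs at most |d| unit shifts. Negating both words handles d < 0. *)
Lemma regular_weight_min x z : regular None x -> word_value x = word_value z ->
  (word_weight x <= word_weight z)%N.
Proof.
elim: z x => [|d z IH] x rx vx.
  have := @regular_weight_offset false 0 [::] x isT rx.
  by rewrite !addn0; apply; rewrite mul0r addr0.
have [x' rx' vx'] := regular_surj (word_value z).
have := IH _ rx' vx'; rewrite word_weight_cons.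
suff: (word_weight x <= word_weight x' + `|d|)%N by lia.
move: vx; rewrite word_value_cons -vx'; case: (ger0P d) => d0 vx.
  by apply: (@regular_weight_shift _ (size z)) => //; rewrite gez0_abs // vx addrC.
rewrite -(word_weight_opp x) -(word_weight_opp x').
apply: (@regular_weight_shift _ (size z)); do ?exact: (@regular_opp None).
by rewrite !word_value_opp vx ltz0_abs //; ring.
Qed.

(** * The norm as the weight of the regular expansion *)

Lemma T_norm_regular x : regular None x -> T_norm (word_value x) = word_weight x.
Proof.
move=> rx; rewrite /T_norm; case: ex_minnP => w /asboolP[z [vz <-]] min.
apply/eqP; rewrite eqn_leq min ?regular_weight_min //.
by apply/asboolP; exists x.
Qed.

Lemma T_norm0 : T_norm 0 = 0%N.
Proof.
have := @T_norm_regular [::] isT.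
by rewrite /word_value big_ord0 /word_weight big_nil.
Qed.

Lemma T_normN N : T_norm (- N) = T_norm N.
Proof.
have [x rx <-] := regular_surj N.
rewrite -word_value_opp !T_norm_regular ?word_weight_opp //.
exact: (@regular_opp None).
Qed.

Lemma T_norm_trib_add k (u : int) :
  - trib_form (1, 0, -1) k < 2 * u < trib_form (-1, 2, 1) k ->
  T_norm (trib k.+2 + u) = (T_norm u).+1.
Proof.
move=> /(@regular_exists (Some (false, false)))[x [rx sx <-]].
have -> : trib k.+2 + word_value x = word_value (1 :: x).
  by rewrite word_value_cons sx mul1r.
rewrite !T_norm_regular ?word_weight_cons ?(regular_None rx) //.
by apply/regularP; exists (Some (false, false)).
Qed.

(* The regular words of length [k] represent the integers of absolute value at
   most [reach k]. *)
Fixpoint reach (k : nat) : nat :=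
  match k with
  | 0 => 0
  | 1 => 1
  | 2 => 2
  | (((k'.+1) as k1).+1 as k2).+1 => (reach k2 + reach k1 + reach k').+1
  end%N.

Lemma reachE k : reach k.+3 = (reach k.+2 + reach k.+1 + reach k).+1.
Proof. by []. Qed.
Arguments reach : simpl never.

Lemma trib_reach k : (2 * reach k + 1)%:Z = trib k.+2 + trib k.
Proof.
suff: [/\ (2 * reach k + 1)%:Z = trib k.+2 + trib k,
  (2 * reach k.+1 + 1)%:Z = trib k.+3 + trib k.+1 &
  (2 * reach k.+2 + 1)%:Z = trib k.+4 + trib k.+2] by case.
elim: k => [//|k [h0 h1 h2]]; split=> //; rewrite reachE.
by move: h0 h1 h2; rewrite (tribE k.+2) (tribE k.+1) (tribE k); lia.
Qed.

(** Hence the integers in ([reach k.+2], [reach k.+3]] are those from T_(k+2) - [reach k.+1] to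
    T_(k+2) + [reach k]: the values of regular words of length k+3 with leading digit 1. *)
Lemma tribonacci_reach k :
  tribonacci k.+2 = (reach k.+2 + reach k.+1).+1.
Proof.
apply/eqP; rewrite -eqz_nat; apply/eqP.
have := trib_reach k.+2; have := trib_reach k.+1.
by rewrite -/(trib k.+4) (tribE k.+1) (tribE k); lia.
Qed.

(** A leading 1 is followed by 0 and then by 0 or -1, never by 1. The range to the right of T_(k+2)
    is therefore shorter than the range to the left. *)
Lemma T_norm_right k v : (v <= reach k)%N ->
  T_norm (tribonacci k.+2 + v)%:Z = (T_norm v%:Z).+1.
Proof.
move=> vk; rewrite PoszD -/(trib k.+4) T_norm_trib_add //.
have := trib_reach k; have := trib_ge0 k; have := trib_ge0 k.+1.
have := trib_ge0 k.+2; rewrite /trib_form /= (tribE k.+1) (tribE k) => ? ? ? ?.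
by apply/andP; split; lia.
Qed.

Lemma T_norm_left k v : (v <= reach k.+1)%N ->
  T_norm (tribonacci k.+2 - v)%N%:Z = (T_norm v%:Z).+1.
Proof.
move=> vk; rewrite -subzn; last by rewrite tribonacci_reach; lia.
rewrite -/(trib k.+4) T_norm_trib_add ?T_normN //.
have := trib_reach k.+1; have := trib_ge0 k; have := trib_ge0 k.+1.
have := trib_ge0 k.+2; rewrite /trib_form /= (tribE k.+1) (tribE k) => ? ? ? ?.
by apply/andP; split; lia.
Qed.

(** * Sums of norms *)

Definition norm_sum (n : nat) : nat := \sum_(N < n) T_norm N%:Z.

Lemma norm_sumS n : norm_sum n.+1 = (norm_sum n + T_norm n%:Z)%N.
Proof. by rewrite /norm_sum big_ord_recr. Qed.

Lemma norm_sum_right k v : (v <= (reach k).+1)%N ->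
  norm_sum (tribonacci k.+2 + v) = (norm_sum (tribonacci k.+2) + v + norm_sum v)%N.
Proof.
elim: v => [|v IH] vk; first by rewrite !addn0 /norm_sum big_ord0 addn0.
rewrite addnS !norm_sumS IH ?(ltnW vk) // T_norm_right //; lia.
Qed.

Lemma norm_sum_left k v : (v <= reach k.+1)%N ->
  (norm_sum (tribonacci k.+2 - v) + v + norm_sum v.+1 =
   norm_sum (tribonacci k.+2))%N.
Proof.
elim: v => [|v IH] vk; first by rewrite subn0 norm_sumS /norm_sum big_ord0 T_norm0; lia.
have vT : (v < tribonacci k.+2)%N by rewrite tribonacci_reach; lia.
have e : (tribonacci k.+2 - v = (tribonacci k.+2 - v.+1).+1)%N by lia.
have := IH (ltnW vk); rewrite {1}e norm_sumS T_norm_left // (norm_sumS v.+1).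
by lia.
Qed.

Lemma norm_sum_tribonacci k : norm_sum (tribonacci k.+2) =
  (norm_sum (reach k.+2).+1 + norm_sum (reach k.+1).+1 + reach k.+1)%N.
Proof.
have := norm_sum_left (leqnn (reach k.+1)); rewrite {1}tribonacci_reach.
by rewrite -addSn addnK; lia.
Qed.

(** The forcing term counts the integers in ([reach k.+2], [reach k.+3]], each of which contributes
    its leading digit. *)
Lemma norm_sum_reach k : norm_sum (reach k.+3).+1 =
  (norm_sum (reach k.+2).+1 + norm_sum (reach k.+1).+1 + norm_sum (reach k).+1
   + reach k.+1 + (reach k).+1)%N.
Proof.
have := norm_sum_right (leqnn (reach k).+1); rewrite norm_sum_tribonacci.
by rewrite tribonacci_reach reachE addnS -!addSn addnS !addSn => ->; lia.
Qed.

Lemma norm_sum_le m n : (m <= n)%N -> (norm_sum m <= norm_sum n)%N.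
Proof.
elim: n => [|n IH]; first by rewrite leqn0 => /eqP ->.
by rewrite leq_eqVlt norm_sumS => /orP[/eqP->|/IH]; rewrite ?norm_sumS //; lia.
Qed.

Lemma reach_le k : (reach k <= reach k.+1)%N.
Proof. by case: k => [|[|[|k]]]//; rewrite (reachE k.+1); lia. Qed.

Lemma reach_leS k : (reach k.+1 <= 3 * reach k + 1)%N.
Proof.
case: k => [|[|k]]//; rewrite reachE.
by have := reach_le k; have := reach_le k.+1; lia.
Qed.

Lemma reach_ge k : (k <= 2 * reach k)%N.
Proof.
suff: (k <= 2 * reach k /\ k.+1 <= 2 * reach k.+1 /\ k.+2 <= 2 * reach k.+2)%N.
  by case.
by elim: k => [//|k IH]; rewrite reachE; lia.
Qed.

Lemma average_norm_sum (R : realType) M :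
  average_T_norm R M = (2 * norm_sum M.+1)%:R / (2 * M + 1)%:R.
Proof.
rewrite /average_T_norm -natr_sum; congr (_%:R / _).
have -> : (2 * M).+1 = (M + M.+1)%N by lia.
rewrite big_split_ord /= mul2n -addnn /norm_sum; congr (_ + _)%N; last first.
  by apply: eq_bigr => i _; congr T_norm; rewrite PoszD; lia.
rewrite big_ord_recl T_norm0 add0n (reindex_inj rev_ord_inj) /=.
apply: eq_bigr => i _; rewrite -T_normN; congr T_norm.
by case: i => i /= iM; rewrite /bump /=; lia.
Qed.

(** * Tribonacci sequences over a field *)

Lemma beta_lt2 (R : realFieldType) (beta : R) : 1 < beta ->
  beta ^+ 3 = beta ^+ 2 + beta + 1 -> beta < 2.
Proof. by move=> b1 b3; nra. Qed.

(* The hypothesis on [g 0], [g 1], [g 2] says that g has no component along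
   beta^k; the quadratic form [Q] is then divided by beta at each step. *)
Lemma tribonacci_bounded (R : realFieldType) (beta : R) (g : nat -> R) :
  1 < beta -> beta ^+ 3 = beta ^+ 2 + beta + 1 ->
  (forall k, g k.+3 = g k.+2 + g k.+1 + g k) ->
  beta * g 2 + beta * (beta - 1) * g 1 + g 0 = 0 ->
  exists2 G, 0 <= G & forall k, `|g k| <= G.
Proof.
move=> b1 b3 gE h0; have b2 := beta_lt2 b1 b3.
(* The cofactor of X - beta in X^3 - X^2 - X - 1 is, up to the factor beta, beta X^2 + beta (beta -
   1) X + 1. *)
have h k : beta * g k.+2 + beta * (beta - 1) * g k.+1 + g k = 0.
  elim: k => [//|k IH]; rewrite gE.
  have -> : beta * (g k.+2 + g k.+1 + g k) + beta * (beta - 1) * g k.+2 + g k.+1 =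
      beta * (beta * g k.+2 + beta * (beta - 1) * g k.+1 + g k)
      - (beta ^+ 3 - beta ^+ 2 - beta - 1) * g k.+1 by ring.
  by rewrite IH b3; ring.
(* This is beta |y - alpha x|^2 for a complex conjugate alpha of beta, and |alpha|^2 = 1 / beta. *)
pose Q x y := beta * y ^+ 2 + beta * (beta - 1) * x * y + x ^+ 2.
have QE x y : Q x y = beta * (y + (beta - 1) / 2 * x) ^+ 2
    + (1 - beta * (beta - 1) ^+ 2 / 4) * x ^+ 2 by rewrite /Q; field.
have coef : 2^-1 <= 1 - beta * (beta - 1) ^+ 2 / 4 by nra.
have Q_ge x y : x ^+ 2 / 2 <= Q x y.
  rewrite QE mulrC; apply: le_trans (_ : (1 - beta * (beta - 1) ^+ 2 / 4) * x ^+ 2 <= _).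
    by apply: ler_wpM2r => //; exact: sqr_ge0.
  by rewrite lerDr mulr_ge0 ?sqr_ge0 //; lra.
have Q_step k : beta * Q (g k.+1) (g k.+2) = Q (g k) (g k.+1).
  have e : beta * g k.+2 = - (beta * (beta - 1) * g k.+1 + g k) by have := h k; lra.
  have -> : beta * Q (g k.+1) (g k.+2) = (beta * g k.+2) ^+ 2 +
     beta * (beta - 1) * g k.+1 * (beta * g k.+2) + beta * g k.+1 ^+ 2.
    by rewrite /Q; ring.
  by rewrite e /Q; ring.
have Q0 x y : 0 <= Q x y by apply: le_trans (Q_ge x y); have := sqr_ge0 x; lra.
have Q_le k : Q (g k) (g k.+1) <= Q (g 0) (g 1).
  elim: k => [//|k IH]; apply: le_trans IH; rewrite -(Q_step k).
  by rewrite ler_peMl // ltW.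
exists (2 * Q (g 0) (g 1) + 1); first by have := Q0 (g 0) (g 1); lra.
move=> k; have := Q_ge (g k) (g k.+1); have := Q_le k.
rewrite -(real_normK (num_real (g k))); have := normr_ge0 (g k).
by nra.
Qed.

Lemma tribonacci_forced (R : realFieldType) (c e g : nat -> R) (G : R) :
  (forall k, 1 <= c k) ->
  (forall k, c k.+3 = c k.+2 + c k.+1 + c k) ->
  (forall k, e k.+3 = e k.+2 + e k.+1 + e k + g k) ->
  (forall k, `|g k| <= G) ->
  exists2 E, 0 <= E & forall k, `|e k| <= E * c k.
Proof.
move=> c1 cE eE gG; have G0 : 0 <= G := le_trans (normr_ge0 _) (gG 0%N).
pose E := `|e 0%N| + `|e 1%N| + `|e 2%N| + G / 2.
have E0 : 0 <= E by rewrite !addr_ge0 //; lra.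
have cE_ge k : E <= E * c k by rewrite ler_peMr.
exists E => // k.
(* The slack G/2 makes the induction close: three copies absorb a forcing of size G and leave
   one. *)
suff: [/\ `|e k| + G / 2 <= E * c k, `|e k.+1| + G / 2 <= E * c k.+1 &
          `|e k.+2| + G / 2 <= E * c k.+2] by case=> + _ _; lra.
elim: k => [|k [h0 h1 h2]].
  have := normr_ge0 (e 0%N); have := normr_ge0 (e 1%N); have := normr_ge0 (e 2%N).
  by split; apply: le_trans (cE_ge _); rewrite /E; lra.
split=> //; rewrite eE cE.
have := ler_normD (e k.+2 + e k.+1 + e k) (g k).
have := ler_normD (e k.+2 + e k.+1) (e k); have := ler_normD (e k.+2) (e k.+1).
by have := gG k; lra.
Qed.

(** The number of integers in [-m_k, m_k]; unlike [reach], it satisfies the homogeneous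
    recurrence. *)
Definition width (R : realFieldType) (k : nat) : R := (2 * reach k + 1)%:R.

Lemma widthE (R : realFieldType) k :
  width R k.+3 = width R k.+2 + width R k.+1 + width R k.
Proof. by rewrite /width -!natrD reachE; congr _%:R; lia. Qed.

Lemma width_ge1 (R : realFieldType) k : 1 <= width R k.
Proof. by rewrite /width ler1n; lia. Qed.

Lemma reach_width (R : realFieldType) k : (reach k)%:R = (width R k - 1) / 2.
Proof. by rewrite /width natrD natrM; field. Qed.

Lemma width_leS (R : realFieldType) k : width R k.+1 <= 3 * width R k.
Proof. by rewrite /width -natrM ler_nat; have := reach_leS k; lia. Qed.

Lemma width_bounds (R : realFieldType) (beta : R) : 1 < beta ->
  beta ^+ 3 = beta ^+ 2 + beta + 1 ->
  forall k, beta ^+ k <= width R k <= 3 * beta ^+ k.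
Proof.
move=> b1 b3 k; have b2 := beta_lt2 b1 b3.
suff: [/\ beta ^+ k <= width R k <= 3 * beta ^+ k,
  beta ^+ k.+1 <= width R k.+1 <= 3 * beta ^+ k.+1 &
  beta ^+ k.+2 <= width R k.+2 <= 3 * beta ^+ k.+2] by case.
elim: k => [|k [h0 h1 h2]].
  have -> : width R 0 = 1 by [].
  have -> : width R 1 = 3 by [].
  have -> : width R 2 = 5 by [].
  by rewrite expr0 expr1; split; apply/andP; split; nra.
split=> //; rewrite widthE.
have -> : beta ^+ k.+3 = beta ^+ k.+2 + beta ^+ k.+1 + beta ^+ k.
  by rewrite -addn3 exprD b3 !exprS; ring.
by move: h0 h1 h2 => /andP[? ?] /andP[? ?] /andP[? ?]; apply/andP; split; lra.
Qed.

Definition density (R : realFieldType) (beta : R) : R := beta ^+ 3 / (beta ^+ 5 + 1).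

(** Numerator and denominator of the density are reduced modulo the cubic equation of beta. *)
Lemma density_eq (R : realFieldType) (beta : R) : 1 < beta ->
  beta ^+ 3 = beta ^+ 2 + beta + 1 ->
  density beta * (4 * beta ^+ 2 + 3 * beta + 3) = beta ^+ 2 + beta + 1.
Proof.
move=> b1 b3.
have b5 : beta ^+ 5 + 1 = 4 * beta ^+ 2 + 3 * beta + 3.
  transitivity (4 * beta ^+ 2 + 3 * beta + 3
    + (beta ^+ 3 - (beta ^+ 2 + beta + 1)) * (beta ^+ 2 + beta + 2)); first by ring.
  by rewrite b3 subrr mul0r addr0.
by rewrite /density -b5 divfK // gt_eqF // ltr_pwDr // ?ltr01 // exprn_ge0 //; lra.
Qed.

Lemma density_ge0 (R : realFieldType) (beta : R) : 1 < beta -> 0 <= density beta.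
Proof. by move=> b1; rewrite /density divr_ge0 ?addr_ge0 ?exprn_ge0 //; lra. Qed.

(** * The average norm *)

Lemma norm_sum_reach_bound (R : realFieldType) (beta : R) : 1 < beta ->
  beta ^+ 3 = beta ^+ 2 + beta + 1 ->
  exists2 E, 0 <= E & forall k,
    `|(norm_sum (reach k).+1)%:R - density beta * k%:R * width R k / 2|
      <= E * width R k.
Proof.
move=> b1 b3; set kappa := density beta; set c := width R.
pose e k : R := (norm_sum (reach k).+1)%:R - kappa * k%:R * c k / 2.
(* The forcing of [e]: the count (c_(k+1) + c_k)/2 from [norm_sum_reach], minus what the index
   shifts in kappa k c_k / 2 produce. *)
pose g k := (c k.+1 + c k - kappa * (c k.+2 + 2 * c k.+1 + 3 * c k)) / 2.
have cE k : c k.+3 = c k.+2 + c k.+1 + c k := widthE R k.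
have [||G G0 gG] := @tribonacci_bounded R beta g b1 b3.
- by move=> k; rewrite /g !cE; field.
- rewrite /g (_ : c 0%N = 1) // (_ : c 1%N = 3) // (_ : c 2%N = 5) //.
  rewrite (_ : c 3%N = 9) // (_ : c 4%N = 17) //.
  have K := density_eq b1 b3; rewrite -/kappa in K.
  have D : 4 * beta ^+ 2 + 3 * beta + 3 != 0 by rewrite gt_eqF //; nra.
  (* Here the value of kappa matters: clearing its denominator leaves a multiple of the cubic. *)
  apply: (mulfI D); rewrite mulr0.
  transitivity ((4 * beta ^+ 2 + 3 * beta + 2) * (4 * beta ^+ 2 + 3 * beta + 3)
    - (14 * beta ^+ 2 + 11 * beta + 7) * (kappa * (4 * beta ^+ 2 + 3 * beta + 3))).
    by field.
  rewrite K; transitivity ((2 * beta + 1) * (beta ^+ 3 - (beta ^+ 2 + beta + 1))).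
    by ring.
  by rewrite b3 subrr mulr0.
apply: (@tribonacci_forced R c e g G) => //; first exact: width_ge1.
move=> k; rewrite /e /g norm_sum_reach !natrD -[in _.+1%:R]addn1 natrD.
rewrite !reach_width -/c !cE.
rewrite -[k.+3]addn3 -[k.+2]addn2 -[in (k.+1)%:R]addn1 !natrD.
by field.
Qed.

Lemma le_width (R : realFieldType) k u : (u <= (reach k).+1)%N -> u%:R <= width R k.
Proof. by rewrite /width ler_nat; lia. Qed.

Lemma index_le_width (R : realFieldType) k : k%:R <= width R k.
Proof. by rewrite /width ler_nat; have := reach_ge k; lia. Qed.

Lemma width_le (R : realFieldType) k : width R k <= width R k.+1.
Proof. by rewrite /width ler_nat; have := reach_le k; lia. Qed.

(** Each case uses only one of the three earlier estimates, so in C c_(k+3) = C (c_(k+2) + c_(k+1) +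
    c_k) the other two widths absorb the index changes and the error at the m_k. *)
Lemma norm_sum_bound (R : realFieldType) (beta : R) : 1 < beta ->
  beta ^+ 3 = beta ^+ 2 + beta + 1 ->
  exists2 C, 0 <= C & forall k u, (u <= (reach k).+1)%N ->
    `|(norm_sum u)%:R - density beta * k%:R * u%:R| <= C * width R k.
Proof.
move=> b1 b3; have [E E0 aE] := norm_sum_reach_bound b1 b3.
move: (density_ge0 b1) aE; set kappa := density beta => kappa0 aE.
(* In the base cases k <= 2 and u <= 3, whence 6 and [norm_sum 3]; the term 2E pays for the errors
   of [aE] at k+1 and k+2. *)
pose C : R := 6 * kappa + 2 * E + 2 + (norm_sum 3)%:R.
have S0 : 0 <= (norm_sum 3)%:R :> R by [].
have C0 : 0 <= C by rewrite /C; lra.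
exists C => //.
pose P k := forall u, (u <= (reach k).+1)%N ->
    `|(norm_sum u)%:R - kappa * k%:R * u%:R| <= C * width R k.
suff: forall k, [/\ P k, P k.+1 & P k.+2] by move=> PP k; case: (PP k).
have base k : (k < 3)%N -> P k.
  move=> k3 u uk; apply: le_trans (_ : C <= _); last by rewrite ler_peMr ?width_ge1.
  have u3 : (u <= 3)%N by apply: leq_trans uk _; case: k k3 => [|[|[|]]].
  have su : (norm_sum u)%:R <= (norm_sum 3)%:R :> R by rewrite ler_nat norm_sum_le.
  have ku : k%:R * u%:R <= 6 :> R.
    by rewrite -natrM ler_nat (@leq_mul k u 2 3).
  have ku0 : 0 <= k%:R * u%:R :> R by [].
  have su0 : 0 <= (norm_sum u)%:R :> R by [].
  rewrite -mulrA ler_norml; apply/andP; rewrite /C.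
  by split; nra.
elim=> [|k [P0 P1 P2]]; first by split; apply: base.
split=> // u uk; rewrite widthE.
pose c0 := width R k; pose c1 := width R k.+1; pose c2 := width R k.+2.
rewrite -/c0 -/c1 -/c2.
have c0_ge1 : 1 <= c0 := width_ge1 R k.
have c01 : c0 <= c1 := width_le R k.
have c12 : c1 <= c2 := width_le R k.+1.
have c21 : c2 <= 3 * c1 := width_leS R k.+1.
have kc0 : 0 <= kappa * (c0 - 1) by rewrite mulr_ge0 // subr_ge0.
have kc01 : 0 <= kappa * (c1 - c0) by rewrite mulr_ge0 // subr_ge0.
have kc12 : 0 <= kappa * (c2 - c1) by rewrite mulr_ge0 // subr_ge0.
have kc21 : 0 <= kappa * (3 * c1 - c2) by rewrite mulr_ge0 // subr_ge0.
have Ec0 : 0 <= E * c0 by rewrite mulr_ge0 //; lra.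
have Ec01 : 0 <= E * (c1 - c0) by rewrite mulr_ge0 // subr_ge0.
have Ec12 : 0 <= E * (c2 - c1) by rewrite mulr_ge0 // subr_ge0.
have Sc0 : 0 <= (norm_sum 3)%:R * c0 by rewrite mulr_ge0 //; lra.
have Sc01 : 0 <= (norm_sum 3)%:R * (c1 - c0) by rewrite mulr_ge0 // subr_ge0.
have Sc12 : 0 <= (norm_sum 3)%:R * (c2 - c1) by rewrite mulr_ge0 // subr_ge0.
have k3E : k.+3%:R = k%:R + 3 :> R by rewrite -addn3 natrD.
have k2E : k.+2%:R = k%:R + 2 :> R by rewrite -addn2 natrD.
have k1E : k.+1%:R = k%:R + 1 :> R by rewrite -addn1 natrD.
have [u2|u2] := leqP u (reach k.+2).+1.
  have := P2 _ u2; rewrite -/c2 k2E k3E.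
  have uw : u%:R <= c2 by exact: le_width.
  have ku : 0 <= kappa * u%:R by rewrite mulr_ge0.
  have ku2 : 0 <= kappa * (c2 - u%:R) by rewrite mulr_ge0 // subr_ge0.
  by rewrite !ler_norml /C => /andP[? ?]; apply/andP; split; lra.
have Tr : (tribonacci k.+2)%:R = (c2 + c1) / 2 :> R.
  by rewrite tribonacci_reach -addn1 !natrD !reach_width -/c1 -/c2; field.
have := aE k.+2; have := aE k.+1; rewrite -/c1 -/c2 k3E k2E k1E.
(* Below T_(k+2) the sum is reflected about T_(k+2); above, it is translated to 0. *)
have [uT|uT] := leqP u (tribonacci k.+2).
  pose v := (tribonacci k.+2 - u)%N.
  have uE : u = (tribonacci k.+2 - v)%N by rewrite /v subKn.
  have vk : (v <= reach k.+1)%N by move: u2; rewrite /v tribonacci_reach; clear; lia.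
  have := P1 _ (vk : (v.+1 <= (reach k.+1).+1)%N); rewrite -/c1 k1E.
  have -> : u%:R = (c2 + c1) / 2 - v%:R :> R.
    by rewrite -Tr uE natrB // /v leq_subr.
  have /(congr1 (fun n => n%:R : R)) := norm_sum_left vk.
  rewrite -uE norm_sum_tribonacci !natrD reach_width -/c1 -[v.+1]addn1 (natrD _ v).
  have v1 : v%:R <= c1 by apply: le_width; exact: leqW.
  have v0 : 0 <= v%:R :> R by [].
  have kv0 : 0 <= kappa * v%:R by rewrite mulr_ge0.
  have kv1 : 0 <= kappa * (c1 - v%:R) by rewrite mulr_ge0 // subr_ge0.
  have kk : 0 <= kappa * (c1 - (k%:R + 1)).
    by rewrite mulr_ge0 // subr_ge0 -k1E index_le_width.
  have kk0 : 0 <= kappa * k%:R by rewrite mulr_ge0.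
  rewrite !ler_norml /C => nE /andP[? ?] /andP[? ?] /andP[? ?].
  by apply/andP; split; lra.
pose v := (u - tribonacci k.+2)%N.
have uE : u = (tribonacci k.+2 + v)%N by rewrite /v subnKC // ltnW.
have vk : (v <= (reach k).+1)%N.
  by move: uk; rewrite /v tribonacci_reach reachE; clear; lia.
have := P0 _ vk; rewrite -/c0.
have -> : u%:R = (c2 + c1) / 2 + v%:R :> R by rewrite -Tr uE natrD.
have /(congr1 (fun n => n%:R : R)) := norm_sum_right vk.
rewrite -uE norm_sum_tribonacci !natrD reach_width -/c1.
have v1 : v%:R <= c0 by exact: le_width.
have v0 : 0 <= v%:R :> R by [].
have kv0 : 0 <= kappa * v%:R by rewrite mulr_ge0.
have kv1 : 0 <= kappa * (c0 - v%:R) by rewrite mulr_ge0 // subr_ge0.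
rewrite !ler_norml /C => nE /andP[? ?] /andP[? ?] /andP[? ?].
by apply/andP; split; lra.
Qed.

Lemma average_T_norm_bound (R : realType) (beta : R) : 1 < beta ->
  beta ^+ 3 = beta ^+ 2 + beta + 1 ->
  exists C : R, forall M, (0 < M)%N ->
    `|average_T_norm R M - density beta * (ln M%:R / ln beta)| <= C.
Proof.
move=> b1 b3; have [C C0 sumP] := norm_sum_bound b1 b3.
have kappa0 := density_ge0 b1.
have lnb : 0 < ln beta by rewrite ln_gt0.
(* L bounds the distance from k + 1 to log M / log beta, using beta^j <= c_j <= 3 beta^j. *)
pose L := (ln 3 + ln beta) / ln beta.
exists (6 * C + 4 * density beta + density beta * L) => M M0.
have [k [kM Mk]] : exists k, ((reach k).+1 <= M)%N /\ (M <= reach k.+1)%N.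
  have : exists k, (M <= reach k)%N.
    by exists (2 * M)%N; have := reach_ge (2 * M); lia.
  case/ex_minnP => -[|k] Mk kmin; first by move: Mk M0; rewrite leqn0 => /eqP->.
  by exists k; split=> //; rewrite ltnNge; apply/negP => /kmin; rewrite ltnn.
have /andP[ck1 ck2] := width_bounds b1 b3 k.
have /andP[dk1 dk2] := width_bounds b1 b3 k.+1.
have M1 : 1 <= M%:R :> R by rewrite ler1n.
have cM : width R k <= 2 * M%:R by rewrite /width -natrM ler_nat; lia.
have cM' : width R k.+1 <= 6 * M%:R by have := width_leS R k; lra.
have kM2 : k%:R <= 2 * M%:R :> R := le_trans (index_le_width R k) cM.
have bpos j : 0 < beta ^+ j by rewrite exprn_gt0 //; lra.
have ln_lo : k%:R * ln beta <= ln 2 + ln M%:R.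
  rewrite -lnM ?posrE //; last by lra.
  rewrite mulr_natl -lnXn; last by lra.
  by rewrite ler_ln ?posrE //; lra.
have ln_hi : ln M%:R <= ln 3 + (k%:R + 1) * ln beta.
  have -> : (k%:R + 1) * ln beta = ln (beta ^+ k.+1).
    by rewrite natr1 mulr_natl lnXn //; lra.
  rewrite -lnM ?posrE // ler_ln ?posrE ?mulr_gt0 //; last by lra.
  by apply: le_trans dk2; apply: le_width; exact: leqW.
have lnL : `|k%:R + 1 - ln M%:R / ln beta| <= L.
  have ln23 : ln 2 <= ln 3 :> R by rewrite ler_ln ?posrE //; lra.
  have -> : k%:R + 1 - ln M%:R / ln beta =
      ((k%:R + 1) * ln beta - ln M%:R) / ln beta by field; rewrite gt_eqF.
  rewrite normrM (gtr0_norm (_ : 0 < (ln beta)^-1)) ?invr_gt0 // /L.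
  rewrite ler_pM2r ?invr_gt0 // ler_norml; apply/andP; split; lra.
have D0 : 0 < (2 * M + 1)%:R :> R by rewrite ltr0n addn1.
have avg : `|average_T_norm R M - density beta * (k%:R + 1)| <= 6 * C + 4 * density beta.
  (* Since 2(M + 1) = (2M + 1) + 1, one extra kappa (k + 1) remains, and k <= 2M keeps its quotient
     bounded. *)
  have -> : average_T_norm R M - density beta * (k%:R + 1) =
      (2 * ((norm_sum M.+1)%:R - density beta * k.+1%:R * M.+1%:R)
       + density beta * (k%:R + 1)) / (2 * M + 1)%:R.
    have kE : k.+1%:R = k%:R + 1 :> R by rewrite natr1.
    have ME : M.+1%:R = M%:R + 1 :> R by rewrite natr1.
    rewrite average_norm_sum natrM (natrD _ (2 * M)) natrM kE ME.
    by field; rewrite -natrM natr1 pnatr_eq0.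
  rewrite normrM (gtr0_norm (_ : 0 < _^-1)) ?invr_gt0 // ler_pdivrMr //.
  have := sumP k.+1 M.+1 Mk; rewrite ler_norml => /andP[lo hi].
  have CM : C * width R k.+1 <= C * (6 * M%:R) by rewrite ler_wpM2l.
  have kk : 0 <= density beta * k%:R by rewrite mulr_ge0.
  have kk2 : density beta * k%:R <= density beta * (2 * M%:R) by rewrite ler_wpM2l.
  have kk3 : 0 <= density beta * (M%:R - 1) by rewrite mulr_ge0 // subr_ge0.
  rewrite natrD natrM ler_norml; apply/andP; split; lra.
have -> : average_T_norm R M - density beta * (ln M%:R / ln beta) =
  (average_T_norm R M - density beta * (k%:R + 1)) +
  density beta * (k%:R + 1 - ln M%:R / ln beta) by ring.
apply: le_trans (ler_normD _ _) _; apply: lerD => //.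
by rewrite normrM ger0_norm // ler_wpM2l.
Qed.

Theorem mainTheorem14 (R : realType) (beta : R)
    (beta_gt1 : 1 < beta)
    (beta_root : beta ^+ 3 = beta ^+ 2 + beta + 1) :
  (fun M : nat => average_T_norm R M) =
    (fun M : nat => beta ^+ 3 / (beta ^+ 5 + 1) * (ln M%:R / ln beta))
    +O_\oo (fun=> 1 : R).
Proof.
have [C CP] := average_T_norm_bound beta_gt1 beta_root.
apply/eqaddOP; exists C; split=> [|c Cc]; first exact: num_real.
near=> M; rewrite normr1 mulr1; apply: le_trans (ltW Cc).
by apply: CP; near: M; exact: nbhs_infty_gt.
Unshelve. all: by end_near. Qed.
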